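(* Let $(X,\|\cdot\|)$ be a real normed space with $\dim X\ge 2$. The following conditions are equivalent (relations on $X$ are regarded as subsets of $X\times X$): (i) $\perp_{B}\subseteq\perp_{\rho_*}$; (ii) $\perp_{B}=\perp_{\rho_*}$; (iii) $\perp_{\rho}\subseteq\perp_{\rho_*}$; (iv) $\perp_{\rho_*}\subseteq\perp_{\rho}$; (v) $\perp_{\rho_*}=\perp_{\rho}$; (vi) $\perp_{\rho_*}\subseteq\perp_{\rho_+}$; (vii) $\perp_{\rho_*}\subseteq\perp_{\rho_-}$; (viii) $\perp_{\rho_*}=\perp_{\rho_-}$; (ix) $X$ is smooth.
   Context: The norm derivatives on a real normed space are $\rho_{\pm}(x,y):=\lim_{t\to 0^{\pm}}\frac{\|x+ty\|^2-\|x\|^2}{2t}$. Put $\rho(x,y):=\frac{1}{2}(\rho_-(x,y)+\rho_+(x,y))$ and $\rho_*(x,y):=\rho_-(x,y)\rho_+(x,y)$. For $\diamondsuit\in\{\rho_-,\rho_+,\rho,\rho_*\}$, $x\perp_{\diamondsuit}y$ iff $\diamondsuit(x,y)=0$. Birkhoff–James orthogonality: $x\perp_B y$ iff $\|x\|\le\|x+\lambda y\|$ for all $\lambda\in\mathbb{R}$. $X$ is smooth if there is a unique supporting hyperplane at each point of the unit sphere (equivalently, the norm is Gâteaux differentiable at every nonzero point). *)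

(* Defs.v *)
From mathcomp Require Import all_boot all_order all_algebra.
From mathcomp Require Import all_classical all_reals all_analysis.

Set Implicit Arguments.
Unset Strict Implicit.
Unset Printing Implicit Defensive.

Import Order.TTheory GRing.Theory Num.Theory.
Import numFieldNormedType.Exports.

Local Open Scope classical_set_scope.
Local Open Scope ring_scope.

Section NormDerivatives.
Context {R : realType} {X : normedModType R}.
Implicit Types x y : X.

Definition norm_quotient x y (t : R) : R :=
  (`|x + t *: y| ^+ 2 - `|x| ^+ 2) / (2 * t).

(* Both one-sided limits exist because the norm is convex, so the default
   value of [lim] is never used. *)
Definition rho_plus x y : R := lim (norm_quotient x y t @[t --> 0^'+]).

Definition rho_minus x y : R := lim (norm_quotient x y t @[t --> 0^'-]).

Definition rho x y : R := (rho_minus x y + rho_plus x y) / 2.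

Definition rho_star x y : R := rho_minus x y * rho_plus x y.

Definition perp (d : X -> X -> R) : set (X * X) := [set p | d p.1 p.2 = 0].

Definition perpB : set (X * X) :=
  [set p | forall l : R, `|p.1| <= `|p.1 + l *: p.2| ].

End NormDerivatives.

Definition dim_ge2 (R : realType) (X : normedModType R) : Prop :=
  exists u v : X, forall a b : R, a *: u + b *: v = 0 -> a = 0 /\ b = 0.

(* A closed hyperplane through [x] with the closed unit ball on one side; the
   inequality fixes no side, since [f] and [c] may be replaced by [- f] and
   [- c]. *)
Definition supporting_hyperplane (R : realType) (X : normedModType R)
    (x : X) (H : set X) : Prop :=
  exists (f : {linear X -> R | *%R}) (c : R),
    [/\ continuous f, exists y, f y != 0, H = [set y | f y = c], H x &
        forall y, `|y| <= 1 -> f y <= c].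

Definition smooth (R : realType) (X : normedModType R) : Prop :=
  forall x : X, `|x| = 1 -> exists! H : set X, supporting_hyperplane x H.

(* Main.v *)
Require Import Defs.
From HB Require Import structures.
From mathcomp Require Import all_boot all_order all_algebra.
From mathcomp Require Import all_classical all_reals all_analysis.
From mathcomp Require Import ring lra.

Import Order.TTheory GRing.Theory Num.Theory.
Import numFieldNormedType.Exports.

Local Open Scope classical_set_scope.
Local Open Scope ring_scope.

(** Write [D x y] for the right derivative at [0] of the convex function
    [t |-> `|x + t *: y|].  Convexity makes the slopes of this function
    nondecreasing in [t], so [D x y] is the infimum of the slopes over [t > 0];
    factoring the difference of squares in [norm_quotient] then gives
    [rho_plus x y = `|x| * D x y], and reflecting [t] gives
    [rho_minus x y = - (`|x| * D x (- y))].  Everything afterwards is algebra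
    with [D x], which is a sublinear functional of norm at most 1, with
    [D x x = `|x|] and [D x (- x) = - `|x|].

    Since [D x] is additive along the line of [x], replacing [y] by
    [y + a *: x] moves [rho_minus x y] and [rho_plus x y] by the same amount
    [a * `|x| ^+ 2] ([exists_shift]).  Hence, if [rho_minus x y < rho_plus x y]
    somewhere, both numbers can be slid along the real line together: putting
    their midpoint at [0] gives a pair orthogonal for [rho] and for
    Birkhoff-James but not for [rho_star], and putting one of them at [0] gives
    a pair orthogonal for [rho_star] but neither for [rho] nor for the other
    one-sided derivative.  So each inclusion of the theorem forces
    [rho_minus = rho_plus], and conversely all five relations coincide under
    this equality, because [perpB] means [rho_minus x y <= 0 <= rho_plus x y]
    ([perpBP]).

    It remains to identify this equality with smoothness
    ([gateaux_smooth]).  The supporting hyperplanes at a unit vector [x] are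
    the sets [f = 1] for the linear [f <= D x].  If [D x] is odd, it is linear
    and is the only such [f].  If hyperplanes are unique, then the functionals
    given by Hahn-Banach that touch [D x] at [y] and at [- y] must be the same
    one, so that [D x (- y) = - D x y]. *)

(** * Sublinear functionals and the Hahn-Banach theorem *)

Section Sublinear.
Set Implicit Arguments.
Unset Strict Implicit.
Context {R : realType} {V : lmodType R}.
Implicit Types (p q : V -> R) (x y v : V).

(** Homogeneity is asked only as an inequality for positive scalars, which is
    what passes to infima; equality follows ([sublinearZ]). *)
Definition sublinear p :=
  (forall x y, p (x + y) <= p x + p y) /\
  (forall a x, 0 < a -> p (a *: x) <= a * p x).

Lemma sublinear0 p : sublinear p -> p 0 = 0.
Proof.
move=> [pD pZ]; have := pD 0 0; have := pZ 2^-1 0.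
by rewrite addr0 scaler0 invr_gt0 ltr0n => /(_ isT); lra.
Qed.

Lemma sublinearZ p a x : sublinear p -> 0 <= a -> p (a *: x) = a * p x.
Proof.
move=> sp; rewrite le_eqVlt => /predU1P[<-|a0].
  by rewrite scale0r mul0r sublinear0.
apply/le_anti/andP; split; first exact: sp.2.
rewrite -ler_pdivlMl//.
have := sp.2 a^-1 (a *: x); rewrite scalerA mulVf ?gt_eqF// scale1r.
by apply; rewrite invr_gt0.
Qed.

Lemma sublinear_oppr_ge p x : sublinear p -> - p (- x) <= p x.
Proof.
move=> sp; have := sp.1 x (- x); rewrite subrr sublinear0//; lra.
Qed.

(** A sublinear functional that is odd at [v] is additive along the line of [v]:
    one inequality is subadditivity, and the other one is subadditivity again
    after adding [- a *: v] back. *)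
Lemma sublinear_additive_line p v a x : sublinear p -> p (- v) <= - p v ->
  p (x + a *: v) = p x + a * p v.
Proof.
move=> sp pv.
have pvE : p (- v) = - p v.
  by apply/le_anti/andP; split=> //; have := sublinear_oppr_ge (- v) sp;
    rewrite opprK; lra.
have pav b : p (b *: v) = b * p v.
  have [b0|b0] := leP 0 b; first exact: sublinearZ.
  rewrite -[b in LHS]opprK scaleNr -scalerN sublinearZ//; last lra.
  by rewrite pvE mulrNN.
apply/le_anti/andP; split; first by rewrite -pav; exact: sp.1.
have := sp.1 (x + a *: v) (- a *: v).
by rewrite scaleNr addrK -scaleNr pav; lra.
Qed.

Lemma sublinear_odd_linear p : sublinear p -> (forall v, p (- v) <= - p v) ->
  linear_for *%R p.
Proof.
move=> sp pN a x y.
rewrite [a *: x + y]addrC (sublinear_additive_line a y sp (pN x)).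
exact: addrC.
Qed.

(** The members [F i] need not be sublinear themselves: it is enough that the
    index can be adapted to the two vectors or to the scalar.  This covers
    chains of sublinear functionals as well as families indexed by a step [t],
    such as the slopes of the norm. *)
Lemma inf_sublinear (I : Type) (A : set I) (F : I -> V -> R) :
  A !=set0 -> (forall x, has_lbound [set F i x | i in A]) ->
  (forall i j x y, A i -> A j ->
     exists2 k, A k & F k (x + y) <= F i x + F j y) ->
  (forall i a x, A i -> 0 < a -> exists2 k, A k & F k (a *: x) <= a * F i x) ->
  sublinear (fun x => inf [set F i x | i in A]).
Proof.
move=> [i0 Ai0] lb FD FZ.
have ne x : [set F i x | i in A] !=set0 by exists (F i0 x), i0.
have le i x : A i -> inf [set F i x | i in A] <= F i x.
  by move=> Ai; apply: ge_inf => //; exists i.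
split=> [x y|a x a0].
  rewrite -lerBlDr; apply: lb_le_inf => // _ [i Ai <-].
  rewrite lerBlDl -lerBlDr; apply: lb_le_inf => // _ [j Aj <-].
  rewrite lerBlDl; have [k Ak kle] := FD i j x y Ai Aj.
  exact: le_trans (le k _ Ak) kle.
rewrite mulrC -ler_pdivrMr//; apply: lb_le_inf => // _ [i Ai <-].
rewrite ler_pdivrMr// mulrC; have [k Ak kle] := FZ i a x Ai a0.
exact: le_trans (le k _ Ak) kle.
Qed.

(** One step towards linearity: the infimum over [t >= 0] of
    [p (x + t *: y) - t * p y] stays below [p] and is odd at [y]. *)
Lemma sublinear_lower p y : sublinear p ->
  exists q, [/\ sublinear q, forall x, q x <= p x & q (- y) <= - p y].
Proof.
move=> sp; pose F (t : R) x := p (x + t *: y) - t * p y.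
pose q x := inf [set F t x | t in [set t | 0 <= t]].
have lbF x : lbound [set F t x | t in [set t | 0 <= t]] (- p (- x)).
  move=> _ [t t0 <-]; rewrite /F.
  have := sp.1 (x + t *: y) (- x).
  by rewrite addrAC subrr add0r sublinearZ//; lra.
have hlb x : has_lbound [set F t x | t in [set t | 0 <= t]].
  by exists (- p (- x)).
exists q; split.
- apply: inf_sublinear => //; first by exists 0 => /=.
  + move=> s t x z s0 t0; exists (s + t); first exact: addr_ge0.
    rewrite /F scalerDl addrACA.
    by have := sp.1 (x + s *: y) (z + t *: y); lra.
  + move=> t a x t0 a0; exists (a * t).
      by apply: mulr_ge0 => //; exact: ltW.
    rewrite /F -scalerA -scalerDr sublinearZ//; last exact: ltW.
    by rewrite mulrBr mulrA.
- move=> x; apply: ge_inf => //; exists 0 => //=.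
  by rewrite /F scale0r addr0 mul0r subr0.
- apply: ge_inf => //; exists 1 => //=.
  by rewrite /F scale1r addNr mul1r sublinear0// sub0r.
Qed.

(** By Zorn's lemma: the infimum of a chain is finite, since every sublinear
    [q <= p] satisfies [- p (- x) <= - q (- x) <= q x]. *)
Lemma exists_minimal_sublinear p : sublinear p ->
  exists q, [/\ sublinear q, forall x, q x <= p x &
    forall q', sublinear q' -> (forall x, q' x <= q x) -> q' = q].
Proof.
move=> sp.
pose T := {q : V -> R | sublinear q /\ forall x, q x <= p x}.
pose le_ (q q' : T) := `[< forall x, sval q' x <= sval q x >].
have [|||C Ctot|[q [sq qp]] qmin] := @Zorn T le_.
- by move=> q; apply/asboolP.
- move=> q1 q2 q3 /asboolP le12 /asboolP le23; apply/asboolP => x.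
  exact: le_trans (le23 x) (le12 x).
- move=> [q1 ?] [q2 ?] /asboolP le12 /asboolP le21.
  by apply/eq_exist/funext => x; apply/le_anti; rewrite le12 le21.
- have [C0|/set0P Cne] := eqVneq C set0.
    exists (exist _ p (conj sp (fun=> lexx _))) => q; by rewrite C0.
  pose m x := inf [set sval q x | q in C].
  have hlb x : has_lbound [set sval q x | q in C].
    exists (- p (- x)) => _ [[q [sq qp]] _ <-] /=.
    apply: le_trans (sublinear_oppr_ge x sq); rewrite lerN2; exact: qp.
  have mle (q : T) x : C q -> m x <= sval q x.
    by move=> Cq; apply: ge_inf => //; exists q.
  have sm : sublinear m.
    apply: (inf_sublinear (F := fun q : T => sval q)) => //.
    + move=> q1 q2 x y C1 C2.
      have [/asboolP le12|/asboolP le21] := Ctot _ _ C1 C2.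
      * exists q2 => //; apply: le_trans ((svalP q2).1.1 x y) _.
        by rewrite lerD2r.
      * exists q1 => //; apply: le_trans ((svalP q1).1.1 x y) _.
        by rewrite lerD2l.
    + by move=> q a x Cq a0; exists q => //; exact: (svalP q).1.2.
  have mp x : m x <= p x.
    have [q Cq] := Cne; exact: le_trans (mle q x Cq) ((svalP q).2 x).
  by exists (exist _ m (conj sm mp)) => q Cq; apply/asboolP => x; exact: mle.
exists q; split=> // q' sq' le'.
have qp' x : q' x <= p x by exact: le_trans (le' x) (qp x).
have := qmin (exist _ q' (conj sq' qp')).
by move=> /(_ (asboolT le')) /(congr1 sval).
Qed.

(** A minimal sublinear functional is linear, because by minimality
    [sublinear_lower] cannot decrease it, so it is odd everywhere.  To reach the
    value [p y], [p] is first lowered at [- y] to [- p y]. *)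
Lemma hahn_banach_sublinear p y : sublinear p ->
  exists f : {linear V -> R | *%R}, (forall x, f x <= p x) /\ f y = p y.
Proof.
move=> sp; have [p1 [sp1 p1p p1y]] := sublinear_lower y sp.
have [q [sq qp1 qmin]] := exists_minimal_sublinear sp1.
have qN v : q (- v) <= - q v.
  have [q' [sq' q'q q'v]] := sublinear_lower v sq.
  by rewrite -[in leLHS](qmin q' sq' q'q).
pose f : {linear V -> R | *%R} :=
  HB.pack q (GRing.isLinear.Build R V R *%R q (sublinear_odd_linear sq qN)).
exists f; split=> [x|]; first exact: le_trans (qp1 x) (p1p x).
apply/le_anti/andP; split; first exact: le_trans (qp1 y) (p1p y).
change (p y <= q y).
have := sublinear_oppr_ge y sq; have := qp1 (- y); lra.
Qed.

End Sublinear.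

(** * The right derivative of the norm *)

Section NormSlope.
Set Implicit Arguments.
Unset Strict Implicit.
Context {R : realType} {X : normedModType R}.
Implicit Types (x y z : X) (s t : R).

Definition norm_slope x t y : R := (`|x + t *: y| - `|x|) / t.

(** Defined as an infimum rather than a limit, so that sublinearity and the
    comparison with each slope are immediate; [norm_slope_cvg] shows that it is
    the right derivative. *)
Definition norm_deriv x y : R :=
  inf [set norm_slope x t y | t in [set t | 0 < t]].

Lemma normZD_le x y z s t : 0 <= s -> 0 <= t ->
  `|(s + t) *: x + (s * t) *: (y + z)|
    <= t * `|x + s *: y| + s * `|x + t *: z|.
Proof.
move=> s0 t0.
have -> : (s + t) *: x + (s * t) *: (y + z)
    = t *: (x + s *: y) + s *: (x + t *: z).
  rewrite !scalerDr !scalerA [t * s]mulrC addrACA -scalerDl.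
  by rewrite [t + s]addrC.
by apply: (le_trans (ler_normD _ _)); rewrite !normrZ !ger0_norm.
Qed.

(** The vector [x + (s * t / (s + t)) *: (y + z)] is the convex combination of
    [x + s *: y] and [x + t *: z] with weights [t / (s + t)] and
    [s / (s + t)]. *)
Lemma norm_slopeD x y z s t : 0 < s -> 0 < t ->
  norm_slope x (s * t / (s + t)) (y + z)
    <= norm_slope x s y + norm_slope x t z.
Proof.
move=> s0 t0; have st0 : 0 < s + t by exact: addr_gt0.
have := normZD_le x y z (ltW s0) (ltW t0).
have -> : (s + t) *: x + (s * t) *: (y + z)
    = (s + t) *: (x + (s * t / (s + t)) *: (y + z)).
  by rewrite [RHS]scalerDr scalerA mulrCA mulfV ?gt_eqF// mulr1.
rewrite normrZ (gtr0_norm st0) /norm_slope => le.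
rewrite ler_pdivrMr; last by rewrite divr_gt0 ?mulr_gt0.
rewrite [leRHS](_ : _ = (t * (`|x + s *: y| - `|x|)
    + s * (`|x + t *: z| - `|x|)) / (s + t)).
  by rewrite ler_pdivlMr//; lra.
by field; rewrite !gt_eqF.
Qed.

Lemma norm_slopeZ x y a t : 0 < a -> 0 < t ->
  norm_slope x (t / a) (a *: y) = a * norm_slope x t y.
Proof.
move=> a0 t0; rewrite /norm_slope scalerA divfK ?gt_eqF//.
by field; rewrite !gt_eqF.
Qed.

Lemma norm_slope_ge x y t : 0 < t -> - `|y| <= norm_slope x t y.
Proof.
move=> t0; rewrite /norm_slope ler_pdivlMr//.
have := ler_normB (x + t *: y) (t *: y).
by rewrite addrK normrZ gtr0_norm//; lra.
Qed.

Lemma norm_slope_le x y t : 0 < t -> norm_slope x t y <= `|y|.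
Proof.
move=> t0; rewrite /norm_slope ler_pdivrMr//.
by have := ler_normD x (t *: y); rewrite normrZ gtr0_norm//; lra.
Qed.

(** The case [z = 0] of [norm_slopeD], whose second slope vanishes. *)
Lemma norm_slope_nondecreasing x y s t : 0 < s -> s <= t ->
  norm_slope x s y <= norm_slope x t y.
Proof.
move=> s0; rewrite le_eqVlt => /predU1P[->//|st].
have t0 := lt_trans s0 st.
(* The step [r] for which [t * r / (t + r) = s]. *)
have r0 : 0 < s * t / (t - s) by rewrite divr_gt0 ?mulr_gt0 ?subr_gt0.
have := norm_slopeD x y 0 t0 r0.
rewrite addr0 {3}/norm_slope scaler0 addr0 subrr mul0r addr0.
congr (norm_slope x _ y <= _).
field; rewrite !gt_eqF ?subr_gt0//=.
by rewrite addr_gt0 ?mulr_gt0 ?subr_gt0.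
Qed.

Lemma has_lbound_norm_slope x y :
  has_lbound [set norm_slope x t y | t in [set t | 0 < t]].
Proof. by exists (- `|y|) => _ [t t0 <-]; exact: norm_slope_ge. Qed.

Lemma norm_deriv_le x y t : 0 < t -> norm_deriv x y <= norm_slope x t y.
Proof.
by move=> t0; apply: ge_inf; [exact: has_lbound_norm_slope|exists t].
Qed.

Lemma norm_deriv_le_norm x y : norm_deriv x y <= `|y|.
Proof. exact: le_trans (norm_deriv_le x y ltr01) (norm_slope_le x y ltr01). Qed.

Lemma le_norm_deriv x y c : (forall t, 0 < t -> c <= norm_slope x t y) ->
  c <= norm_deriv x y.
Proof.
move=> cle; apply: lb_le_inf; first by exists (norm_slope x 1 y), 1 => /=.
by move=> _ [t t0 <-]; exact: cle.
Qed.

Lemma norm_deriv_sublinear x : sublinear (norm_deriv x).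
Proof.
apply: inf_sublinear; first by exists 1 => /=.
- exact: has_lbound_norm_slope.
- move=> s t y z s0 t0; exists (s * t / (s + t)); last exact: norm_slopeD.
  by apply: divr_gt0; [exact: mulr_gt0|exact: addr_gt0].
- move=> t a y t0 a0; exists (t / a); first exact: divr_gt0.
  by rewrite norm_slopeZ.
Qed.

Lemma norm_deriv_self x : norm_deriv x x = `|x|.
Proof.
apply/le_anti; rewrite norm_deriv_le_norm; apply: le_norm_deriv => t t0.
rewrite /norm_slope -[in X in `|X + _|](scale1r x) -scalerDl normrZ.
have t1 : 0 < 1 + t by exact: addr_gt0.
by rewrite (gtr0_norm t1) ler_pdivlMr//; lra.
Qed.

(** The slope towards [- x] with step [1] is already [- `|x|]. *)
Lemma norm_deriv_oppr_self x : norm_deriv x (- x) <= - norm_deriv x x.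
Proof.
apply: (le_trans (norm_deriv_le x (- x) ltr01)).
by rewrite norm_deriv_self /norm_slope scale1r subrr normr0 sub0r divr1.
Qed.

Lemma norm_deriv_shift x y a :
  norm_deriv x (y + a *: x) = norm_deriv x y + a * `|x|.
Proof.
rewrite (sublinear_additive_line _ _ (norm_deriv_sublinear x)).
  by rewrite norm_deriv_self.
exact: norm_deriv_oppr_self.
Qed.

Lemma norm_slopeZl x y a t : 0 < a ->
  norm_slope (a *: x) (a * t) y = norm_slope x t y.
Proof.
move=> a0; rewrite /norm_slope -scalerA -scalerDr !normrZ gtr0_norm//.
by rewrite -mulrBr -mulf_div divff ?mul1r ?gt_eqF.
Qed.

Lemma norm_derivZl x y a : 0 < a -> norm_deriv (a *: x) y = norm_deriv x y.
Proof.
have le b z : 0 < b -> norm_deriv (b *: z) y <= norm_deriv z y.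
  move=> b0; apply: le_norm_deriv => t t0; rewrite -(norm_slopeZl z y t b0).
  exact/norm_deriv_le/mulr_gt0.
move=> a0; apply/le_anti; rewrite le//=.
have := le a^-1 (a *: x); rewrite scalerA mulVf ?gt_eqF// scale1r invr_gt0.
exact.
Qed.

(** * The norm derivatives *)

Lemma norm_slope_cvg x y :
  norm_slope x t y @[t --> 0^'+] --> norm_deriv x y.
Proof.
have -> : norm_deriv x y =
    inf ((norm_slope x)^~ y @` [set` Interval (BRight 0) (BInfty R false)]).
  by rewrite set_itvoy.
apply: nondecreasing_at_right_cvgr => //.
- move=> s t; rewrite !in_itv/= !andbT => s0 _.
  exact: norm_slope_nondecreasing.
- by rewrite set_itvoy; exact: has_lbound_norm_slope.
Qed.

Lemma norm_quotientE x y t : t != 0 ->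
  norm_quotient x y t = norm_slope x t y * ((`|x + t *: y| + `|x|) / 2).
Proof. by move=> t0; rewrite /norm_quotient /norm_slope; field. Qed.

(** The difference of squares factors into a slope, which tends to the
    derivative, and the mean of the two norms, which tends to [`|x|]. *)
Lemma norm_quotient_cvg_right x y :
  norm_quotient x y t @[t --> 0^'+] --> `|x| * norm_deriv x y.
Proof.
have nD : `|x + t *: y| @[t --> 0^'+] --> `|x|.
  apply: cvg_norm; rewrite -[in X in _ --> X](addr0 x) -(scale0r y).
  apply: cvgD; first exact: cvg_cst.
  by apply: cvgZr_tmp; apply: cvg_at_right_filter; exact: cvg_id.
have : norm_slope x t y * ((`|x + t *: y| + `|x|) / 2) @[t --> 0^'+]
    --> norm_deriv x y * ((`|x| + `|x|) / 2).
  apply: cvgM; first exact: norm_slope_cvg.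
  apply: cvgMr_tmp; apply: cvgD => //; exact: cvg_cst.
rewrite [(_ + _) / 2](_ : _ = `|x|); last by lra.
rewrite mulrC.
apply: cvg_trans; apply: near_eq_cvg; near=> t.
by rewrite norm_quotientE.
Unshelve. all: by end_near. Qed.

Lemma rho_plusE x y : rho_plus x y = `|x| * norm_deriv x y.
Proof. exact/cvg_lim/norm_quotient_cvg_right. Qed.

Lemma norm_quotientN x y t :
  norm_quotient x y (- t) = - norm_quotient x (- y) t.
Proof. by rewrite /norm_quotient scaleNr scalerN mulrN invrN mulrN. Qed.

Lemma rho_minusE x y : rho_minus x y = - (`|x| * norm_deriv x (- y)).
Proof.
apply/cvg_lim => //; apply/cvg_at_leftNP; rewrite oppr0.
rewrite (_ : _ \o _ = fun t => - norm_quotient x (- y) t); last first.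
  by apply/funext => t /=; rewrite norm_quotientN.
apply: cvgN; exact: norm_quotient_cvg_right.
Qed.

Lemma rho_minus_le_plus x y : rho_minus x y <= rho_plus x y.
Proof.
rewrite rho_minusE rho_plusE -mulrN ler_wpM2l//.
exact/sublinear_oppr_ge/norm_deriv_sublinear.
Qed.

Lemma rho_plus_shift x y a :
  rho_plus x (y + a *: x) = rho_plus x y + a * `|x| ^+ 2.
Proof. by rewrite !rho_plusE norm_deriv_shift; ring. Qed.

Lemma rho_minus_shift x y a :
  rho_minus x (y + a *: x) = rho_minus x y + a * `|x| ^+ 2.
Proof.
by rewrite !rho_minusE (opprD y) -(scaleNr a x) norm_deriv_shift; ring.
Qed.

(** Moving [y] along [x] slides both norm derivatives by one common, arbitrary
    amount [c]; the strict inequality only serves to exclude [x = 0]. *)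
Lemma exists_shift x y c : rho_minus x y < rho_plus x y ->
  exists z, rho_minus x z = rho_minus x y - c /\
    rho_plus x z = rho_plus x y - c.
Proof.
move=> lt; have x0 : `|x| != 0.
  by apply: contraTneq lt => x0;
    rewrite rho_minusE rho_plusE x0 !mul0r oppr0 ltxx.
exists (y + (- c / `|x| ^+ 2) *: x).
by rewrite rho_minus_shift rho_plus_shift divfK ?expf_neq0.
Qed.

(** By convexity, [`|x + t *: v|] stays above [`|x|] for [t > 0] exactly when
    its right derivative at [0] is nonnegative; this is used for [v = y] and for
    [v = - y]. *)
Lemma perpBP x y : perpB (x, y) <-> rho_minus x y <= 0 <= rho_plus x y.
Proof.
have side v : (forall t, 0 < t -> `|x| <= `|x + t *: v|) <->
    0 <= `|x| * norm_deriv x v.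
  have [->|x0] := eqVneq x 0.
    rewrite normr0 mul0r; split=> // _ t _; exact: normr_ge0.
  rewrite pmulr_rge0 ?normr_gt0//; split=> [le|ge0 t t0].
    apply: le_norm_deriv => t t0; apply: divr_ge0; last exact: ltW.
    by rewrite subr_ge0 le.
  have := le_trans ge0 (norm_deriv_le x v t0).
  by rewrite /norm_slope pmulr_lge0 ?invr_gt0// subr_ge0.
rewrite /perpB/= rho_minusE rho_plusE oppr_le0; split=> [le|/andP[ge0N ge0]].
  apply/andP; split; apply/side => t _ //.
  by rewrite scalerN -scaleNr.
move=> t; have [t0|t0|->] := ltgtP t 0.
- rewrite -[t]opprK scaleNr -scalerN.
  by move/side : ge0N; apply; rewrite oppr_gt0.
- by move/side : ge0; apply.
- by rewrite scale0r addr0.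
Qed.

End NormSlope.

(** * Smoothness and orthogonality relations *)

Section Smooth.
Set Implicit Arguments.
Unset Strict Implicit.
Context {R : realType} {X : normedModType R}.
Implicit Types (x y z : X) (f g : {linear X -> R | *%R}).

(** At [x = 0] both derivatives vanish, and at [x != 0] the equality says that
    [t |-> `|x + t *: y|] is differentiable at [0]: the norm is Gateaux
    differentiable away from [0]. *)
Definition gateaux : Prop := forall x y, rho_minus x y = rho_plus x y.

(** Both derivatives scale with [x], so unit vectors suffice, and there the
    equality of the derivatives is oddness of [norm_deriv x]. *)
Lemma gateauxP : gateaux <->
  (forall x y, `|x| = 1 -> norm_deriv x (- y) <= - norm_deriv x y).
Proof.
split=> [E x y x1|H x y].
  by have := E x y; rewrite rho_minusE rho_plusE x1 !mul1r; lra.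
apply/le_anti; rewrite rho_minus_le_plus /=.
rewrite rho_minusE rho_plusE -mulrN.
have [->|x0] := eqVneq x 0; first by rewrite normr0 !mul0r.
have nx : 0 < `|x| by rewrite normr_gt0.
rewrite ler_wpM2l// lerNr -!(norm_derivZl x _ (a := `|x|^-1)) ?invr_gt0//.
by apply: H; rewrite normrZ normfV normr_id mulVf ?gt_eqF.
Qed.

Lemma dominated_continuous f : (forall y, f y <= `|y|) -> continuous f.
Proof.
move=> fle x; apply/cvgrPdist_le => e e0.
near=> y; rewrite -raddfB.
have : `|x - y| <= e.
  near: y; move: e e0; apply/cvgrPdist_le; exact: cvg_id.
apply: le_trans; rewrite ler_norml fle andbT lerNl -raddfN.
by rewrite -[leRHS]normrN fle.
Unshelve. all: by end_near. Qed.

Lemma supporting_norm_deriv x f : `|x| = 1 ->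
  (forall y, f y <= norm_deriv x y) ->
  supporting_hyperplane x [set y | f y = 1].
Proof.
move=> x1 fle.
have fle_norm y : f y <= `|y|.
  exact: le_trans (fle y) (norm_deriv_le_norm x y).
have fx : f x = 1.
  apply/le_anti; rewrite -{1}x1 fle_norm /=.
  have := le_trans (fle (- x)) (norm_deriv_oppr_self x).
  by rewrite norm_deriv_self x1 raddfN lerN2.
exists f, 1; split=> //; first exact: dominated_continuous.
- by exists x; rewrite fx oner_neq0.
- by move=> y; apply: le_trans.
Qed.

(** The hyperplane fixes [f] only up to a scalar.  Here the level [c] is positive,
    as otherwise [f <= 0] everywhere and [f = 0]; dividing by [c] normalizes
    [f], and [f <= 1] on the unit ball becomes a bound by the slopes at [x]. *)
Lemma supporting_functional x (H : set X) : `|x| = 1 ->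
  supporting_hyperplane x H ->
  exists2 f : {linear X -> R | *%R},
    forall y, f y <= norm_deriv x y & H = [set y | f y = 1].
Proof.
move=> x1 [f [c [_ [y0 fy0] HE Hx fle]]].
have fx : f x = c by move: Hx; rewrite HE.
have fle_norm y : f y <= c * `|y|.
  have [->|y_neq0] := eqVneq y 0; first by rewrite raddf0 normr0 mulr0.
  have ny : 0 < `|y| by rewrite normr_gt0.
  rewrite -ler_pdivrMr// mulrC -scalarZ; apply: fle.
  by rewrite normrZ normfV normr_id mulVf ?gt_eqF.
have c0 : 0 < c.
  rewrite ltNge; apply/negP => c_le0.
  have f_le0 y : f y <= 0.
    by apply: le_trans (fle_norm y) _; rewrite mulr_le0_ge0.
  move/negP: fy0; apply; apply/eqP/le_anti.
  by rewrite f_le0 -oppr_le0 -raddfN f_le0.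
have glin : linear_for *%R (fun y => c^-1 * f y).
  by move=> a y z; rewrite linearP mulrDr mulrCA.
pose g : {linear X -> R | *%R} :=
  HB.pack (fun y => c^-1 * f y) (GRing.isLinear.Build R X R *%R _ glin).
exists g => [y|].
  apply: le_norm_deriv => t t0; rewrite /norm_slope x1 ler_pdivlMr//=.
  have := fle_norm (x + t *: y); rewrite addrC linearP fx [_ + x]addrC => fxy.
  rewrite -(ler_pM2l c0) mulrBr mulr1 mulrA mulrA mulfV ?gt_eqF// mul1r.
  by lra.
rewrite HE; apply/seteqP; split=> y /=; first by move->; rewrite mulVf ?gt_eqF.
by move=> /(congr1 ( *%R c)); rewrite mulrA mulfV ?gt_eqF// mul1r mulr1.
Qed.

(** Every vector can be moved along [x] into the common level set. *)
Lemma level_set_inj f g x : f x = 1 -> g x = 1 ->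
  [set y | f y = 1] = [set y | g y = 1] -> forall y, f y = g y.
Proof.
move=> fx gx fg y.
have : [set z | f z = 1] ((1 - f y) *: x + y).
  by rewrite /= linearP fx mulr1 subrK.
by rewrite fg /= linearP gx mulr1; lra.
Qed.

(** If [norm_deriv x] is odd, it is itself the unique linear functional below
    itself.  Conversely, uniqueness identifies the functional that agrees with
    [norm_deriv x] at [y] with the one that agrees with it at [- y]. *)
Lemma gateaux_smooth : gateaux <-> smooth X.
Proof.
split=> [/gateauxP pN x x1|sm].
  have plin := sublinear_odd_linear (norm_deriv_sublinear x) (pN x ^~ x1).
  pose f : {linear X -> R | *%R} :=
    HB.pack (norm_deriv x) (GRing.isLinear.Build R X R *%R _ plin).
  exists [set y | f y = 1]; split; first exact: supporting_norm_deriv.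
  move=> H /(supporting_functional x1)[g gle ->].
  suff -> : (f : X -> R) = g by [].
  apply/funext => y; apply/le_anti; rewrite gle andbT.
  have := le_trans (gle (- y)) (pN x y x1); rewrite raddfN lerN2; exact.
apply/gateauxP => x y x1.
have sp := norm_deriv_sublinear x.
have [f [fle fy]] := hahn_banach_sublinear y sp.
have [g [gle gy]] := hahn_banach_sublinear (- y) sp.
have [H [_ Huniq]] := sm x x1.
have sf := supporting_norm_deriv x1 fle.
have sg := supporting_norm_deriv x1 gle.
have [fx gx] : f x = 1 /\ g x = 1.
  by case: sf sg => ? [? [_ _ _ + _]] [? [? [_ _ _ + _]]].
have fg : f y = g y.
  by apply: (level_set_inj fx gx); rewrite -(Huniq _ sf) -(Huniq _ sg).
by rewrite -gy -fy raddfN fg.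
Qed.

(** The function [c] of the two norm derivatives is the amount by which they are
    slid to produce a pair in [A] but not in [B]. *)
Lemma subset_gateaux (A B : set (X * X)) (c : R -> R -> R) :
  (forall x z a b, a < b -> rho_minus x z = a - c a b ->
     rho_plus x z = b - c a b -> A (x, z) /\ ~ B (x, z)) ->
  A `<=` B -> gateaux.
Proof.
move=> counter AB x y; apply/eqP; rewrite eq_le rho_minus_le_plus /= leNgt.
apply/negP => lt.
have [z [zm zp]] := exists_shift (c (rho_minus x y) (rho_plus x y)) lt.
by have [/AB] := counter _ _ _ _ lt zm zp.
Qed.

(** The slide puts the midpoint of the two derivatives at [0], so that they become
    opposite and nonzero, with a negative product. *)
Lemma subset_perp_star_gateaux (A : set (X * X)) :
  (forall x z, rho_minus x z <= 0 -> rho_minus x z = - rho_plus x z ->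
     A (x, z)) ->
  A `<=` perp rho_star -> gateaux.
Proof.
move=> Amid; apply: (subset_gateaux (c := fun a b => (a + b) / 2)).
move=> x z a b ab zm zp; split; first by apply: Amid; lra.
rewrite /perp /= /rho_star zm zp => /eqP; rewrite mulf_eq0 => /orP[]/eqP; lra.
Qed.

Lemma perpB_sub_gateaux : perpB `<=` perp (@rho_star R X) -> gateaux.
Proof.
apply: subset_perp_star_gateaux => x z z0 zm.
by apply/perpBP; rewrite z0 -oppr_le0 -zm.
Qed.

Lemma perp_rho_sub_gateaux : perp (@rho R X) `<=` perp rho_star -> gateaux.
Proof.
apply: subset_perp_star_gateaux => x z _ zm.
by rewrite /perp /= /rho zm addNr mul0r.
Qed.

(** Here and in the next two lemmas the slide puts one of the derivatives at [0],
    which leaves the other one nonzero. *)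
Lemma perp_star_sub_rho_gateaux :
  perp (@rho_star R X) `<=` perp rho -> gateaux.
Proof.
apply: (subset_gateaux (c := fun a _ => a)) => x z a b ab zm zp.
by rewrite /perp /= /rho_star /rho zm zp subrr mul0r; split=> //; lra.
Qed.

Lemma perp_star_sub_plus_gateaux :
  perp (@rho_star R X) `<=` perp rho_plus -> gateaux.
Proof.
apply: (subset_gateaux (c := fun a _ => a)) => x z a b ab zm zp.
by rewrite /perp /= /rho_star zm zp subrr mul0r; split=> //; lra.
Qed.

Lemma perp_star_sub_minus_gateaux :
  perp (@rho_star R X) `<=` perp rho_minus -> gateaux.
Proof.
apply: (subset_gateaux (c := fun _ b => b)) => x z a b ab zm zp.
by rewrite /perp /= /rho_star zm zp subrr mulr0; split=> //; lra.
Qed.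

Lemma gateaux_perp : gateaux ->
  [/\ perpB = perp (@rho_plus R X), perp (@rho_star R X) = perp rho_plus,
      perp (@rho R X) = perp rho_plus & perp (@rho_minus R X) = perp rho_plus].
Proof.
move=> G; split; apply/seteqP; split=> -[x y]; rewrite /perp /=.
- by move/perpBP; rewrite G => /le_anti.
- by move=> y0; apply/perpBP; rewrite G y0 lexx.
- by rewrite /rho_star G => /eqP; rewrite mulf_eq0 orbb => /eqP.
- by rewrite /rho_star => ->; rewrite mulr0.
- by rewrite /rho G; lra.
- by rewrite /rho G; lra.
- by rewrite G.
- by rewrite G.
Qed.

End Smooth.

Theorem theorem3p1 (R : realType) (X : normedModType R) (dimX : dim_ge2 X) :
  [<-> (perpB : set (X * X)) `<=` perp rho_star;
       (perpB : set (X * X)) = perp rho_star;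
       perp (@rho R X) `<=` perp rho_star;
       perp (@rho_star R X) `<=` perp rho;
       perp (@rho_star R X) = perp rho;
       perp (@rho_star R X) `<=` perp rho_plus;
       perp (@rho_star R X) `<=` perp rho_minus;
       perp (@rho_star R X) = perp rho_minus;
       smooth X].
Proof.
have Gperp := @gateaux_perp R X.
tfae.
- by move=> /perpB_sub_gateaux/Gperp[-> -> _ _].
- move=> BE; suff /Gperp[_ -> -> _] : @gateaux R X by [].
  by apply: perpB_sub_gateaux; rewrite BE.
- by move=> /perp_rho_sub_gateaux/Gperp[_ -> -> _].
- by move=> /perp_star_sub_rho_gateaux/Gperp[_ -> -> _].
- move=> rhoE; suff /Gperp[_ -> _ _] : @gateaux R X by [].
  by apply: perp_star_sub_rho_gateaux; rewrite rhoE.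
- by move=> /perp_star_sub_plus_gateaux/Gperp[_ -> _ ->].
- by move=> /perp_star_sub_minus_gateaux/Gperp[_ -> _ ->].
- move=> minusE; apply/gateaux_smooth/perp_star_sub_minus_gateaux.
  by rewrite minusE.
- by move/gateaux_smooth/Gperp => [-> -> _ _].
Qed.
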